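(* There exists an absolute constant $D>0$ such that the following holds. Let $n\ge 2$, let $\mathbf{A}\in\mathbb{R}^{m\times n}$ be a random matrix whose rows are independent, isotropic and sub-gaussian random vectors in $\mathbb{R}^n$, and let $F$ be the maximum of the sub-gaussian norms of the rows of $\mathbf{A}$. Let $u\ge 1$ and let the integer $s\ge1$ satisfy $$\frac{m}{s}>D\,F^4\,u\log n.$$ Then, with probability at least $1-2e^{-u}$, $$\inf_{\mathbf{h}\in\ker(\mathbf{A})\setminus\{\mathbf{0}\}}\frac{\|\mathbf{h}\|_1}{\|\mathbf{h}\|_2}>3\sqrt{s}.$$
   Context: A random vector $X\in\mathbb{R}^n$ is isotropic if $\mathbb{E}[XX^T]=\mathbf{I}_n$. It is sub-gaussian if $\|\mathbf{a}^TX\|_{\Psi_2}=\inf\{t>0:\ \mathbb{E}[e^{|\mathbf{a}^TX|^2/t^2}]\le 2\}<\infty$ for all $\mathbf{a}\in\mathbb{R}^n$, and its sub-gaussian norm is $\|X\|_{\Psi_2}=\sup_{\|\mathbf{a}\|_2=1}\|\mathbf{a}^TX\|_{\Psi_2}$. The infimum over the empty set is $+\infty$. *)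

(* Defs.v *)
From HB Require Import structures.
From mathcomp Require Import all_boot all_order all_algebra.
From mathcomp Require Import all_classical all_reals all_analysis.

Set Implicit Arguments.
Unset Strict Implicit.
Unset Printing Implicit Defensive.

Import Order.TTheory GRing.Theory Num.Theory numFieldNormedType.Exports.

Local Open Scope classical_set_scope.
Local Open Scope ring_scope.

Definition borel_mx (R : realType) (m n : nat) :=
  g_sigma_algebraType (@open 'M[R]_(m, n)).

Section random_vectors.
Context (d : measure_display) (Omega : measurableType d) (R : realType).
Variable P : probability Omega R.

Definition mutually_independent (I : finType) (d' : measure_display)
    (T : measurableType d') (X : I -> Omega -> T) : Prop :=
  forall (J : {set I}) (B : I -> set T), (forall i, measurable (B i)) ->
  P (\bigcap_(i in [set` J]) (X i @^-1` B i)) =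
  (\prod_(i in J) P (X i @^-1` B i))%E.

Definition psi2_norm (Y : Omega -> R) : \bar R :=
  ereal_inf [set t%:E | t in
    [set t : R | 0 < t /\
       ('E_P[fun w => expR (`|Y w| ^+ 2 / t ^+ 2)] <= 2%:E)%E]].

Definition vdot (n : nat) (a x : 'cV[R]_n) : R := (a^T *m x) 0 0.

Definition l1norm (n : nat) (x : 'cV[R]_n) : R := \sum_i `|x i 0|.

Definition l2norm (n : nat) (x : 'cV[R]_n) : R :=
  Num.sqrt (\sum_i x i 0 ^+ 2).

(* The integral of a function whose positive and negative parts both have
   infinite integral is -oo, so the equalities below force every entry of
   X X^T to be integrable. *)
Definition isotropic (n : nat) (X : Omega -> 'cV[R]_n) : Prop :=
  forall i j : 'I_n,
    'E_P[fun w => (X w *m (X w)^T) i j]%E = ((1%:M : 'M[R]_n) i j)%:E.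

Definition subgaussian (n : nat) (X : Omega -> 'cV[R]_n) : Prop :=
  forall a : 'cV[R]_n, (psi2_norm (fun w => vdot a (X w)) < +oo)%E.

Definition subgaussian_norm (n : nat) (X : Omega -> 'cV[R]_n) : \bar R :=
  ereal_sup [set psi2_norm (fun w => vdot a (X w)) |
    a in [set a : 'cV[R]_n | l2norm a = 1]].

(* Rows are taken as column vectors. *)
Definition mx_row (m n : nat) (A : Omega -> 'M[R]_(m, n)) (i : 'I_m)
  (w : Omega) : 'cV[R]_n := (row i (A w))^T.

Definition max_row_norm (m n : nat) (A : Omega -> 'M[R]_(m, n)) : \bar R :=
  \big[maxe/0%E]_(i < m) subgaussian_norm (mx_row A i).

End random_vectors.

(* mathcomp's kermx is the left kernel; this is the kernel of h |-> A h. *)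
Definition right_ker (R : realType) (m n : nat) (A : 'M[R]_(m, n)) :
  set 'cV[R]_n := [set h | A *m h = 0].

Definition ker_ratio (R : realType) (m n : nat) (A : 'M[R]_(m, n)) : \bar R :=
  ereal_inf [set (l1norm h / l2norm h)%:E | h in right_ker A `\ 0].

(* Main.v *)
(* Write [Q z = |A z|^2 - (m/2) |z|^2] and let [F] be the maximal sub-gaussian
   norm. Bernstein-type bounds for the independent variables [<A_i, a>^2], which
   have mean 1 for a unit vector [a], give [m/2 <= |A a|^2 <= 2 m] up to
   probability [exp (- c m / F^4)]. By a union bound, with [k] a constant
   multiple of [s], [Q] is then nonnegative at all the [(2 n)^k] sums of [k]
   signed basis vectors, and all columns of [A] have squared norm at most [2 m].
   On this event, sample [k] independent signed basis vectors with mean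
   [x / |x|_1] (Maurey's empirical method): the mean of [Q] at their sum is
   [k (k - 1) Q(x / |x|_1)] plus at most [k (3 m / 2)], and it is nonnegative.
   If [A x = 0], this reads [(k - 1) |x|_2^2 <= 3 |x|_1^2]. Since the atoms
   already form a finite set, neither a net nor chaining is needed. *)
Require Import Defs.
From HB Require Import structures.
From mathcomp Require Import all_boot all_order all_algebra.
From mathcomp Require Import finmap.
From mathcomp Require Import all_classical all_reals all_analysis.
From mathcomp Require Import measurable_realfun zify ring lra.

Set Implicit Arguments.
Unset Strict Implicit.
Unset Printing Implicit Defensive.

Import Order.TTheory GRing.Theory Num.Theory numFieldNormedType.Exports.

Local Open Scope classical_set_scope.
Local Open Scope ring_scope.

(** * Measurability of the kernel ratio *)

Section borel_matrices.
Context (R : realType) (m n : nat).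

Lemma open_measurable_borel_mx (U : set 'M[R]_(m, n)) :
  open U -> measurable (U : set (borel_mx R m n)).
Proof. by move=> oU; apply: sub_sigma_algebra. Qed.

Lemma continuous_borel_mx_fun (f : 'M[R]_(m, n) -> R) :
  continuous f -> measurable_fun setT (f : borel_mx R m n -> R).
Proof.
move=> /continuousP cf; apply: (measurability _ (RGenOpens.measurableE R)).
move=> _ [_ [a [b ->] <-]]; rewrite setTI; apply: open_measurable_borel_mx.
exact/cf/interval_open.
Qed.

Lemma continuous_borel_mx_map (p q : nat) (f : 'M[R]_(m, n) -> 'M[R]_(p, q)) :
  continuous f ->
  measurable_fun setT (f : borel_mx R m n -> borel_mx R p q).
Proof.
move=> /continuousP cf; apply: (@measurability _ _
  (borel_mx R m n) (borel_mx R p q) setT f (@open 'M[R]_(p, q)) erefl).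
move=> _ [U oU <-]; rewrite setTI; apply: open_measurable_borel_mx.
exact: cf.
Qed.

Lemma continuous_to_mx (T : topologicalType) (f : T -> 'M[R]_(m, n)) :
  (forall i j, continuous (fun x => f x i j)) -> continuous f.
Proof.
move=> cf x; apply/cvg_ballP => e e0.
have : \forall y \near x, forall k : 'I_m * 'I_n,
    ball (f x k.1 k.2) e (f y k.1 k.2).
  by apply: filter_forall => k; move/cvg_ballP: (cf k.1 k.2 x); apply.
by apply: filterS => y fxy; split=> // i j; exact: (fxy (i, j)).
Qed.

End borel_matrices.

Lemma sum_continuous (R : realType) (T : topologicalType) (I : Type)
    (r : seq I) (P : pred I) (f : I -> T -> R) :
  (forall i, continuous (f i)) ->
  continuous (fun x => \sum_(i <- r | P i) f i x).
Proof.
move=> cf; apply: (@continuous_big R I +%R 0 P) => [|i _]; last exact: cf.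
exact: add_continuous.
Qed.

Section ker_ratio_measurable.
Context (R : realType) (m n : nat).

Lemma sum_sqr_gt0 (v : 'cV[R]_n) : v != 0 -> 0 < \sum_i v i 0 ^+ 2.
Proof.
move=> v0; have ge0 i : true -> 0 <= v i 0 ^+ 2 by move=> _; exact: sqr_ge0.
rewrite lt_def (sumr_ge0 _ ge0) andbT; apply: contra v0 => v0.
have {}v0 i : v i 0 ^+ 2 == 0.
  move: v0; rewrite psumr_eq0// => /allP /(_ i); apply.
  by rewrite mem_index_enum.
apply/eqP/matrixP => i j; rewrite mxE ord1; apply/eqP.
by rewrite -sqrf_eq0; exact: v0.
Qed.

Lemma l2norm_gt0 (v : 'cV[R]_n) : v != 0 -> 0 < l2norm v.
Proof. by move=> v0; rewrite sqrtr_gt0 sum_sqr_gt0. Qed.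

Lemma l2normZ (a : R) (v : 'cV[R]_n) : l2norm (a *: v) = `|a| * l2norm v.
Proof.
rewrite /l2norm -sqrtr_sqr -sqrtrM ?sqr_ge0// mulr_sumr.
by congr Num.sqrt; apply: eq_bigr => i _; rewrite mxE exprMn.
Qed.

Lemma l1normZ (a : R) (v : 'cV[R]_n) : l1norm (a *: v) = `|a| * l1norm v.
Proof.
by rewrite /l1norm mulr_sumr; apply: eq_bigr => i _; rewrite mxE normrM.
Qed.

(** The normalised vectors whose ratio of norms is at most [q]. Row vectors are used because
    [bounded_closed_compact] is about them. *)
Definition sphere_cap (q : R) : set 'rV[R]_n :=
  [set v | \sum_i v 0 i ^+ 2 = 1 /\ \sum_i `|v 0 i| <= q].

Lemma sphere_cap_compact (q : R) : compact (sphere_cap q).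
Proof.
have cc i : continuous (fun v : 'rV[R]_n => v 0 i) by exact: coord_continuous.
apply: bounded_closed_compact.
  exists 1; split; first exact: num_real.
  move=> M M1 v [v1 _]; apply: le_trans (ltW M1).
  rewrite [leLHS]/Num.norm/= mx_normrE; apply/bigmax_leP.
  split => // -[i j] _ /=.
  rewrite ord1 -[leRHS]sqrtr1 -v1 -sqrtr_sqr ler_sqrt; last first.
    by apply: sumr_ge0 => k _; exact: sqr_ge0.
  rewrite (bigD1 j)//= lerDl sumr_ge0// => k _; exact: sqr_ge0.
apply: closedI.
  apply: (@closed_comp _ _ (fun v : 'rV[R]_n => \sum_i v 0 i ^+ 2) [set 1]).
    move=> v _; apply: sum_continuous => i {}v.
    exact: continuous_comp (cc i v) (@exprn_continuous _ 2 _).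
  exact: closed_eq.
apply: (@closed_comp _ _ (fun v : 'rV[R]_n => \sum_i `|v 0 i|)
  [set x | x <= q]).
  move=> v _; apply: sum_continuous => i {}v.
  exact: continuous_comp (cc i v) (@norm_continuous _ _ _).
exact: closed_le.
Qed.

(** Tube lemma: [A *m v^T != 0] is an open condition on the pair of [v] and [A], and compactness of
    [K] makes the neighbourhood of [A] uniform in [v]. *)
Lemma open_no_kernel (K : set 'rV[R]_n) : compact K ->
  open [set A : 'M[R]_(m, n) | K `<=` [set v | A *m v^T != 0]].
Proof.
move=> /compact_near_coveringP cK; rewrite openE => A0 /= KA0.
apply: (cK _ (nbhs A0) (fun A v => A *m v^T != 0) _) => v Kv.
have cA : continuous (fun z : 'rV[R]_n * 'M[R]_(m, n) => z.2 *m z.1^T).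
  apply: continuous_to_mx => i j.
  rewrite [X in continuous X](_ : _ =
      fun z : 'rV[R]_n * 'M[R]_(m, n) => \sum_k z.2 i k * z.1 j k);
    last first.
    by apply/funext => z; rewrite mxE; under eq_bigr do rewrite mxE.
  apply: sum_continuous => k z; apply: continuousM.
    apply: (@continuous_comp _ _ _ snd (fun M : 'M[R]_(m, n) => M i k)).
      exact: cvg_snd.
    exact: coord_continuous.
  apply: (@continuous_comp _ _ _ fst (fun M : 'rV[R]_n => M j k)).
    exact: cvg_fst.
  exact: coord_continuous.
have /matrix0Pn [i [j ij]] : A0 *m v^T != 0 by exact: KA0.
have cij : continuous (fun z : 'rV[R]_n * 'M[R]_(m, n) => (z.2 *m z.1^T) i j).
  by move=> z; exact: continuous_comp (cA z) (@coord_continuous _ _ _ _ _ _).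
have nz : nbhs ((A0 *m v^T) i j) [set x | x != 0].
  by apply: open_nbhs_nbhs; split; [exact: open_neq|exact: ij].
apply: (@filterS _ (nbhs (v, A0)) _ _ _ _ (cij (v, A0) _ nz)) => -[w A] /= Aij.
by apply/matrix0Pn; exists i, j.
Qed.

(** A strict bound on an infimum leaves room for some [q] in between, and homogeneity reduces the
    kernel to its unit vectors. The strict condition thus becomes one on a compact set. *)
Lemma ker_ratio_gtP (A : 'M[R]_(m, n)) (c : R) : 0 <= c ->
  (c%:E < ker_ratio A)%E <->
  exists2 q : R, c < q & sphere_cap q `<=` [set v | A *m v^T != 0].
Proof.
move=> c0; split.
  move=> cA.
  have [q cq qA] : exists2 q : R, c < q & (q%:E < ker_ratio A)%E.
    move: cA; case: (ker_ratio A) => [r| |]//.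
      rewrite lte_fin => cr; exists ((c + r) / 2); first by lra.
      by rewrite lte_fin; lra.
    (* The ratio is [+oo] when the kernel is trivial; any [q] above [c] then works. *)
    by move=> _; exists (c + 1); rewrite ?ltry//; lra.
  exists q => // v [v1 vq] /=; apply/eqP => Av.
  have l2v : l2norm v^T = 1.
    by rewrite /l2norm -[RHS]sqrtr1 -v1; under eq_bigr do rewrite mxE.
  have : (ker_ratio A <= (l1norm v^T / l2norm v^T)%:E)%E.
    apply: ereal_inf_lbound; exists v^T => //; split=> //= v0.
    move: l2v; rewrite v0 /l2norm big1; last by move=> i _; rewrite mxE expr0n.
    by rewrite sqrtr0 => /esym/eqP; rewrite oner_eq0.
  move=> /(lt_le_trans qA); rewrite l2v divr1 lte_fin; apply/negP.
  rewrite -leNgt.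
  by rewrite /l1norm; under eq_bigr do rewrite mxE.
move=> [q cq Kq]; apply: (@lt_le_trans _ _ q%:E); first by rewrite lte_fin.
apply: le_ereal_inf_tmp => _ [h [/= Ah /eqP h0] <-].
rewrite lee_fin leNgt; apply/negP => hq.
have l2h := l2norm_gt0 h0.
suff cap : sphere_cap q ((l2norm h)^-1 *: h)^T.
  by have := Kq _ cap; rewrite /= trmxK -scalemxAr Ah scaler0 eqxx.
split.
  transitivity ((l2norm h)^-1 ^+ 2 * (l2norm h) ^+ 2).
    rewrite [in RHS]/l2norm sqr_sqrtr; last first.
      by apply: sumr_ge0 => i _; exact: sqr_ge0.
    by rewrite mulr_sumr; apply: eq_bigr => i _; rewrite !mxE exprMn.
  by rewrite -exprMn mulVf ?expr1n// gt_eqF.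
suff -> : \sum_i `|((l2norm h)^-1 *: h)^T 0 i| = l1norm h / l2norm h.
  exact: ltW.
rewrite mulrC -[X in X * _]gtr0_norm ?invr_gt0// -l1normZ.
by apply: eq_bigr => i _; rewrite mxE.
Qed.

(** A union over [q] of the open sets given by the tube lemma. This is what makes the event of the
    theorem measurable. *)
Lemma open_ker_ratio_gt (c : R) : 0 <= c ->
  open [set A : 'M[R]_(m, n) | (c%:E < ker_ratio A)%E].
Proof.
move=> c0.
rewrite (_ : mkset _ = \bigcup_(q in [set q | c < q])
    [set A | sphere_cap q `<=` [set v | A *m v^T != 0]]); last first.
  apply/seteqP; split => [A /(ker_ratio_gtP _ c0) [q]|A [q cq Kq]].
    by move=> cq Kq; exists q.
  by apply/(ker_ratio_gtP _ c0); exists q.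
apply: bigcup_open => q _; apply: open_no_kernel; exact: sphere_cap_compact.
Qed.

End ker_ratio_measurable.

(** * Maurey's empirical method *)

Section empirical_method.
Context (R : realFieldType).

Lemma exists_le_average (I : finType) (p g : I -> R) (c : R) :
  (forall a, 0 <= p a) -> \sum_a p a = 1 -> \sum_a p a * g a <= c ->
  exists a, g a <= c.
Proof.
move=> p0 p1 gc; apply/not_existsP => gt_c.
have pg0 a : true -> 0 <= p a * (g a - c).
  move=> _; rewrite mulr_ge0// subr_ge0 ltW// ltNge; apply/negP; exact: gt_c.
have : \sum_a p a * (g a - c) <= 0.
  under eq_bigr do rewrite mulrBr.
  by rewrite sumrB -mulr_suml p1 mul1r subr_le0.
rewrite le_eqVlt ltNge sumr_ge0// orbF psumr_eq0// => /allP pg.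
have : \sum_a p a = 0; last by rewrite p1 => /eqP; rewrite oner_eq0.
apply: big1 => a _; have := pg a (mem_index_enum a); rewrite /= mulf_eq0.
move=> /orP[/eqP//|]; rewrite subr_eq0 => /eqP gac.
by exfalso; apply: (gt_c a); rewrite gac.
Qed.

Context (n : nat) (M : 'M[R]_n).

Definition quad_form (z : 'cV[R]_n) : R := (z^T *m M *m z) 0 0.

Context (I : finType) (p : I -> R) (v : I -> 'cV[R]_n).
Hypotheses (p_ge0 : forall a, 0 <= p a) (p_sum1 : \sum_a p a = 1).
Let y := \sum_a p a *: v a.

(** The cross terms are linear in [v a] and average to those of the mean [y], so only the purely
    quadratic term sees the spread. The excess is a variance that does not depend on [w], which
    allows the samples to be drawn one after the other. *)
Lemma quad_form_average (w : 'cV[R]_n) :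
  \sum_a p a * quad_form (w + v a) =
  quad_form (w + y) + (\sum_a p a * quad_form (v a) - quad_form y).
Proof.
have expand (u : 'cV[R]_n) : quad_form (w + u) =
    quad_form w + (w^T *m M *m u) 0 0 + (u^T *m M *m w) 0 0 + quad_form u.
  rewrite /quad_form [(w + u)^T]raddfD/=. rewrite !mulmxDl !mulmxDr.
  by rewrite !mxE; ring.
under eq_bigr do rewrite expand !mulrDr.
rewrite !big_split/= -mulr_suml p_sum1 mul1r expand.
have -> : \sum_a p a * (w^T *m M *m v a) 0 0 = (w^T *m M *m y) 0 0.
  rewrite mulmx_sumr summxE; apply: eq_bigr => a _.
  by rewrite -scalemxAr [in RHS]mxE.
have -> : \sum_a p a * ((v a)^T *m M *m w) 0 0 = (y^T *m M *m w) 0 0.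
  rewrite linear_sum/= !mulmx_suml summxE; apply: eq_bigr => a _.
  by rewrite linearZ/= -!scalemxAl [in RHS]mxE.
by ring.
Qed.

(* Method of conditional expectations: the right-hand side is the mean of
   [quad_form] at [z] plus [r] independent samples of [v] under [p]. *)
Lemma quad_form_sample (r : nat) (z : 'cV[R]_n) :
  exists s : r.-tuple I,
    quad_form (z + \sum_(a <- s) v a) <=
    quad_form (z + r%:R *: y) +
    r%:R * (\sum_a p a * quad_form (v a) - quad_form y).
Proof.
elim: r z => [|r IHr] z.
  by exists (nil_tuple I); rewrite big_nil scale0r mul0r !addr0.
pose c := \sum_a p a * quad_form (v a) - quad_form y.
(* One sample is fixed while the other [r] are still held at their mean [y]; each fixed sample costs
   one variance [c]. *)
have [a za] : exists a, quad_form (z + r%:R *: y + v a) <=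
    quad_form (z + r.+1%:R *: y) + c.
  apply: (exists_le_average p_ge0 p_sum1).
  by rewrite quad_form_average -/c -natr1 scalerDl scale1r [z + (_ + _)]addrA.
have [s zas] := IHr (z + v a).
exists (cons_tuple a s); rewrite /= big_cons addrA.
rewrite (le_trans zas)// -/c; move: za; rewrite [_ + v a]addrAC.
by rewrite -[X in _ -> _ <= _ + X * _]natr1 mulrDl mul1r; lra.
Qed.

End empirical_method.

(** * Comparison of the two norms on the kernel, by sampling signed basis vectors *)

Section signed_basis.
Context (R : realType) (n : nat).

(** The vertices of the unit ball of the l1 norm; [true] is the minus sign. *)
Definition signed_basis (a : 'I_n * bool) : 'cV[R]_n :=
  (-1) ^+ a.2 *: delta_mx a.1 0.

(** All of the weight [|x_i|] goes to the vertex that carries the sign of [x_i], so that nothing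
    cancels. The weights become probabilities after division by [l1norm x]. *)
Lemma signed_basis_average (x : 'cV[R]_n) :
  exists p : 'I_n * bool -> R, [/\ forall a, 0 <= p a,
    \sum_a p a = l1norm x & \sum_a p a *: signed_basis a = x].
Proof.
exists (fun a => if a.2 == (x a.1 0 < 0) then `|x a.1 0| else 0); split.
- by move=> a; case: ifP.
- rewrite -(pair_bigA _ (fun i b => if b == (x i 0 < 0) then `|x i 0| else 0))/=.
  apply: eq_bigr => i _; rewrite big_bool/=.
  by case: (x i 0 < 0); rewrite ?addr0 ?add0r.
- rewrite -(pair_bigA _ (fun i b => (if b == (x i 0 < 0) then `|x i 0| else 0)
    *: signed_basis (i, b)))/=.
  apply/matrixP => j k; rewrite ord1 summxE (bigD1 j)//= [X in _ + X]big1 ?addr0.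
    rewrite big_bool/= /signed_basis/= !mxE !eqxx/=.
    by case: ltP => h; rewrite /= ?(expr1, expr0) ?(ltr0_norm h) ?(ger0_norm h); lra.
  move=> i ij; rewrite big_bool/= /signed_basis !mxE (eq_sym j i) (negbTE ij)/=.
  by rewrite !mulr0 addr0.
Qed.

End signed_basis.

Section kernel_ratio.
Context (R : realType) (m n : nat) (A : 'M[R]_(m, n)).

(** Repetitions and cancellations are allowed, so an atom may be 0. *)
Definition atom (k : nat) (s : k.-tuple ('I_n * bool)) : 'cV[R]_n :=
  \sum_(a <- s) signed_basis R a.

Definition sqnorm (q : nat) (z : 'cV[R]_q) : R := \sum_i z i 0 ^+ 2.

Lemma sqnormE (q : nat) (z : 'cV[R]_q) : sqnorm z = (z^T *m z) 0 0.
Proof. by rewrite mxE; apply: eq_bigr => i _; rewrite mxE expr2. Qed.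

Lemma quad_form_gram (c : R) (z : 'cV[R]_n) :
  quad_form (A^T *m A - c%:M) z = sqnorm (A *m z) - c * sqnorm z.
Proof.
rewrite !sqnormE /quad_form mulmxBr mulmxBl mxE trmx_mul !mulmxA; congr (_ + _).
by rewrite mxE mul_mx_scalar -scalemxAl mxE.
Qed.

Lemma sqnorm_signed_basis (a : 'I_n * bool) : sqnorm (signed_basis R a) = 1.
Proof.
rewrite /sqnorm (bigD1 a.1)//= big1 ?addr0.
  by rewrite !mxE !eqxx mulr1 sqrr_sign.
by move=> i ia; rewrite !mxE (negbTE ia) mulr0 expr0n.
Qed.

Lemma sqnorm_col (a : 'I_n * bool) :
  sqnorm (A *m signed_basis R a) = \sum_i A i a.1 ^+ 2.
Proof.
apply: eq_bigr => i _; rewrite -scalemxAr mxE exprMn sqrr_sign mul1r.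
by rewrite -colE mxE.
Qed.

Lemma ker_l1_l2 (k : nat) : (0 < k)%N -> (0 < m)%N ->
  (forall s : k.-tuple ('I_n * bool),
    m%:R / 2 * sqnorm (atom s) <= sqnorm (A *m atom s)) ->
  (forall j, \sum_i A i j ^+ 2 <= 2 * m%:R) ->
  forall x, x != 0 -> A *m x = 0 -> (k%:R - 1) * sqnorm x <= 3 * l1norm x ^+ 2.
Proof.
move=> k0 m0 atoms cols x x0 Ax.
have [p [p0 p1 px]] := signed_basis_average x.
have L0 : 0 < l1norm x.
  rewrite lt_def sumr_ge0// andbT; apply: contra x0; rewrite -p1 psumr_eq0//.
  move=> /allP p00; rewrite -px big1// => a _.
  by have /eqP -> := p00 a (mem_index_enum a); rewrite scale0r.
have p'0 a : 0 <= p a / l1norm x by rewrite divr_ge0// ltW.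
have p'1 : \sum_a p a / l1norm x = 1 by rewrite -mulr_suml p1 divff ?gt_eqF.
have px' : \sum_a (p a / l1norm x) *: signed_basis R a = (l1norm x)^-1 *: x.
  by rewrite -[X in _ = _ *: X]px scaler_sumr; apply: eq_bigr => a _;
    rewrite scalerA mulrC.
(* [M] is the matrix of the form [Q]. *)
pose M := A^T *m A - (m%:R / 2)%:M.
have [s] := quad_form_sample M (@signed_basis R n) p'0 p'1 k 0.
rewrite px' !add0r -/(atom s) => hs.
have := atoms s; rewrite -subr_ge0 -quad_form_gram -/M => /le_trans/(_ hs) {hs}.
have qB a : quad_form M (signed_basis R a) <= 3 / 2 * m%:R.
  rewrite quad_form_gram sqnorm_signed_basis sqnorm_col.
  by have := cols a.1; lra.
have avg : \sum_a p a / l1norm x * quad_form M (signed_basis R a) <= 3 / 2 * m%:R.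
  have -> : 3 / 2 * m%:R = \sum_a p a / l1norm x * (3 / 2 * m%:R) :> R.
    by rewrite -[RHS]mulr_suml p'1 mul1r.
  apply: ler_sum => a _.
  by apply: ler_wpM2l; [exact: p'0|exact: qB].
have qx (c : R) : quad_form M (c *: x) = - (m%:R / 2 * (c ^+ 2 * sqnorm x)).
  rewrite quad_form_gram -scalemxAr Ax scaler0.
  rewrite [X in X - _](_ : _ = 0) ?sub0r; last first.
    by rewrite /sqnorm big1// => i _; rewrite mxE expr0n.
  congr (- (_ * _)); rewrite /sqnorm mulr_sumr; apply: eq_bigr => i _.
  by rewrite mxE exprMn.
rewrite scalerA !qx.
have k0' : 0 < k%:R :> R by rewrite ltr0n.
have m0' : 0 < m%:R :> R by rewrite ltr0n.
move: avg; set a := (\sum_a _); set L := l1norm x in L0 *.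
move: (sqnorm x) => S avg h.
(* On the kernel [Q] is [- m / 2] times the squared norm. The mean of the samples contributes it
   [k ^+ 2] times and the variance takes it back [k] times, which leaves the factor [k - 1] after
   division by [k]. *)
have : 0 <= - (m%:R / 2 * ((k%:R / L) ^+ 2 * S)) +
  k%:R * (3 / 2 * m%:R + (m%:R / 2 * (L^-1 ^+ 2 * S))).
  apply: le_trans h _; rewrite lerD2l ler_wpM2l ?ler0n//.
  by rewrite opprK lerD2r.
rewrite [X in 0 <= X -> _](_ : _ =
   (m%:R / 2 * k%:R / L ^+ 2) * (3 * L ^+ 2 - (k%:R - 1) * S)).
  by rewrite pmulr_rge0 ?subr_ge0// !(mulr_gt0, invr_gt0, exprn_gt0).
by field; rewrite gt_eqF.
Qed.

End kernel_ratio.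

(** * Products of independent variables *)

Section independence.
Context (d d' : measure_display) (Omega : measurableType d)
  (T : measurableType d') (R : realType) (P : probability Omega R).

Import HBNNSimple.

Local Open Scope ereal_scope.

Let measurable_indic_comp (X : Omega -> T) (B : set T) :
  measurable_fun setT X -> measurable B ->
  measurable_fun setT (fun w => \1_B (X w) : R).
Proof.
by move=> mX mB; exact: (measurableT_comp (measurable_indic mB)).
Qed.

(** Linearity over the level sets of [h]. The constant [c] plays the mean of [V]. *)
Lemma nnsfun_integral_decouple (V : Omega -> R) (X : Omega -> T)
    (h : {nnsfun T >-> R}) (c : \bar R) :
  measurable_fun setT V -> (forall w, 0 <= V w)%R ->
  measurable_fun setT X ->
  (forall B, measurable B ->
    \int[P]_w (V w * \1_B (X w))%:E = c * \int[P]_w (\1_B (X w))%:E) ->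
  \int[P]_w (V w * h (X w))%:E = c * \int[P]_w (h (X w))%:E.
Proof.
move=> mV V0 mX VB.
have [N [r [r0 hE]]] : exists N (r : 'I_N -> R), (forall i, 0 <= r i)%R /\
    forall t, h t = (\sum_i r i * \1_(h @^-1` [set r i]) t)%R.
  pose s := finmap.enum_fset (fset_set (range h)).
  exists (size s), (fun i => nth 0%R s i); split; last first.
    by move=> t; exact: fimfunEord.
  move=> i; set y := nth _ _ _; have : y \in fset_set (range h).
    exact: (@mem_nth _ 0%R s).
  by rewrite in_fset_set// => /set_mem[t _ <-].
pose B i := h @^-1` [set r i].
have mB i : measurable (B i).
  by rewrite -[X in measurable X]setTI; exact: (measurable_funPT h).
have mXB i : measurable_fun setT (fun w => \1_(B i) (X w) : R).
  exact: measurable_indic_comp.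
have XB0 i w : (0 <= \1_(B i) (X w) :> R)%R by [].
transitivity (\sum_i
    (r i)%:E * \int[P]_w (V w * \1_(B i) (X w))%:E).
  under [RHS]eq_bigr => i _.
    rewrite -ge0_integralZl_EFin//; last first.
    - by apply/measurable_EFinP; exact: measurable_funM.
    - by move=> w _; rewrite lee_fin mulr_ge0.
    over.
  rewrite -ge0_integral_sum//; last 2 first.
  - move=> i; apply: emeasurable_funM => //.
    by apply/measurable_EFinP; exact: measurable_funM.
  - by move=> i w _; rewrite -EFinM lee_fin !mulr_ge0.
  apply: eq_integral => w _; rewrite hE mulr_sumr -sumEFin.
  by apply: eq_bigr => i _; rewrite -EFinM mulrCA.
transitivity (\sum_i
    c * ((r i)%:E * \int[P]_w (\1_(B i) (X w))%:E)).
  by apply: eq_bigr => i _; rewrite VB// muleCA.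
rewrite -ge0_sume_distrr; last first.
  move=> i _; apply: mule_ge0; first by rewrite lee_fin.
  by apply: integral_ge0 => w _; rewrite lee_fin.
congr (_ * _).
under eq_bigr => i _.
  rewrite -ge0_integralZl_EFin//; last first.
  - exact/measurable_EFinP.
  over.
rewrite -ge0_integral_sum//; last 2 first.
- by move=> i; apply: emeasurable_funM => //; exact/measurable_EFinP.
- by move=> i w _; rewrite -EFinM lee_fin mulr_ge0.
apply: eq_integral => w _; rewrite hE -sumEFin.
by apply: eq_bigr => i _; rewrite -EFinM.
Qed.

(** Monotone convergence along simple functions increasing to [g]; finiteness of [c] makes
    multiplication by [c] pass to the limit. *)
Lemma ge0_integral_decouple (V : Omega -> R) (X : Omega -> T) (g : T -> R)
    (c : \bar R) :
  measurable_fun setT V -> (forall w, 0 <= V w)%R ->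
  measurable_fun setT X ->
  measurable_fun setT g -> (forall t, 0 <= g t)%R ->
  c \is a fin_num ->
  (forall B, measurable B ->
    \int[P]_w (V w * \1_B (X w))%:E = c * \int[P]_w (\1_B (X w))%:E) ->
  \int[P]_w (V w * g (X w))%:E = c * \int[P]_w (g (X w))%:E.
Proof.
move=> mV V0 mX mg g0 cfin VB.
have mgE : measurable_fun [set: T] (EFin \o g) by exact/measurable_EFinP.
pose h := nnsfun_approx measurableT mgE.
have hg t : (h k t)%:E @[k --> \oo] --> (g t)%:E.
  by apply: (cvg_nnsfun_approx measurableT mgE) => // x _; rewrite lee_fin.
have nd_h t a b : (a <= b)%O -> (h a t <= h b t)%R.
  by move=> ab; exact/lefP/nd_nnsfun_approx.
have mh k : measurable_fun setT (h k \o X) by exact: measurableT_comp.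
have lim1 : \int[P]_w (V w * h k (X w))%:E @[k --> \oo] -->
    \int[P]_w (V w * g (X w))%:E.
  rewrite [X in _ --> X](_ : _ =
      \int[P]_w (limn (fun k => (V w * h k (X w))%:E))); last first.
    apply: eq_integral => w _; apply/esym/cvg_lim => //.
    by rewrite EFinM; under eq_fun do rewrite EFinM; exact: cvgeZl.
  apply: cvg_monotone_convergence => //.
  - by move=> k; apply/measurable_EFinP; exact: (measurable_funM mV (mh k)).
  - by move=> k w _; rewrite lee_fin mulr_ge0.
  - by move=> w _ a b ab; rewrite lee_fin ler_wpM2l// nd_h.
have lim2 : \int[P]_w (h k (X w))%:E @[k --> \oo] --> \int[P]_w (g (X w))%:E.
  rewrite [X in _ --> X](_ : _ =
      \int[P]_w (limn (fun k => (h k (X w))%:E))); last first.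
    by apply: eq_integral => w _; apply/esym/cvg_lim.
  apply: cvg_monotone_convergence => //.
  - by move=> k; apply/measurable_EFinP; exact: mh.
  - by move=> k w _; rewrite lee_fin.
  - by move=> w _ a b ab; rewrite lee_fin nd_h.
apply: (cvg_unique _ lim1) => //.
rewrite (_ : (fun k => _) = fun k => c * \int[P]_w (h k (X w))%:E).
  exact: cvgeZl.
by apply/funext => k; exact: nnsfun_integral_decouple.
Qed.

(** Independence is the case of indicators. They are exchanged for general functions one index at a
    time, by induction on a list outside which every [g i] is an indicator. *)
Lemma independent_integral_prod (I : finType) (X : I -> Omega -> T)
    (g : I -> T -> R) :
  (forall i, measurable_fun setT (X i)) ->
  mutually_independent P X ->
  (forall i, measurable_fun setT (g i)) -> (forall i t, 0 <= g i t)%R ->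
  (forall i, \int[P]_w (g i (X i w))%:E < +oo) ->
  \int[P]_w (\prod_i g i (X i w))%R%:E = \prod_i \int[P]_w (g i (X i w))%:E.
Proof.
move=> mX indep mg g0 goo.
have int_indic (A : set Omega) : measurable A -> \int[P]_w (\1_A w)%:E = P A.
  by move=> mA; rewrite integral_indic// setIT.
have mXB i B : measurable B -> measurable (X i @^-1` B).
  by move=> mB; rewrite -[X in measurable X]setTI; exact: mX.
have : forall i, i \notin enum I -> exists2 B, measurable B & g i = \1_B.
  by move=> i; rewrite mem_enum.
elim: (enum I) g mg g0 goo => [|i s IHs] g mg g0 goo gB.
  pose B i := projT1 (cid2 (gB i isT)).
  have mB i : measurable (B i) by rewrite /B; case: cid2.
  have gE i : g i = \1_(B i) by rewrite /B; case: cid2.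
  (* With an empty list all factors are indicators, and the claim is independence over the full
     index set. *)
  have := indep [set: I]%SET B mB.
  rewrite [X in _ = X](_ : _ = \prod_i \int[P]_w (g i (X i w))%:E); last first.
    apply: eq_big => [i|i _]; first by rewrite inE.
    rewrite gE; apply/esym.
    exact: (int_indic (X i @^-1` B i) (mXB _ _ (mB i))).
  move=> <-; rewrite -int_indic; last first.
    apply: fin_bigcap_measurable => [|i _]; first exact: finite_finset.
    exact: mXB.
  apply: eq_integral => w _; congr (_%:E); rewrite indicE.
  have [wB|/existsNP [i wB]] := pselect (forall i, B i (X i w)).
    rewrite mem_set; last by move=> i _; exact: wB.
    by rewrite big1// => i _; rewrite gE indicE mem_set.
  rewrite memNset; last first.
    by move=> /(_ i); apply: contra_not wB; apply; rewrite /= inE.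
  by rewrite (bigD1 i)//= gE indicE memNset ?mul0r.
pose V w := (\prod_(j | j != i) g j (X j w))%R.
have mgX j : measurable_fun setT (fun w => g j (X j w)).
  exact: (measurableT_comp (mg j)).
have fin j : \int[P]_w (g j (X j w))%:E \is a fin_num.
  by rewrite ge0_fin_numE// integral_ge0// => w _; rewrite lee_fin.
pose c := \prod_(j | j != i) \int[P]_w (g j (X j w))%:E.
rewrite [RHS](bigD1 i)//= muleC.
under eq_integral do rewrite (bigD1 i)//= mulrC.
apply: (@ge0_integral_decouple V (X i) (g i) c) => //.
- rewrite /V; under eq_fun do rewrite -big_filter.
  by apply: measurable_prod => j _.
- by move=> w; apply: prodr_ge0.
- by apply: prode_fin_num.
move=> B mB.
(* With an indicator at [i], the shorter list suffices for the induction hypothesis; it gives the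
   decoupling of [V] from [X i] on measurable sets. *)
pose g' j := if j == i then \1_B else g j.
have g'i : g' i = \1_B by rewrite /g' eqxx.
have g'j j : j != i -> g' j = g j by rewrite /g' => /negbTE ->.
have := IHs g'.
rewrite [in X in _ -> _ -> _ -> _ -> _ = X](bigD1 i)//= g'i muleC.
rewrite [in X in _ -> _ -> _ -> _ -> _ = X * _](eq_bigr
    (fun j => \int[P]_w (g j (X j w))%:E)); last first.
  by move=> j /g'j ->.
move=> <-.
- apply: eq_integral => w _.
  rewrite [in RHS](bigD1 i)//= g'i mulrC; congr (_ * _)%:E.
  by apply: eq_bigr => j /g'j ->.
- by move=> j; rewrite /g'; case: ifP.
- by move=> j t; rewrite /g'; case: ifP.
- move=> j; rewrite /g'; case: ifP => // _.
  rewrite (_ : \int[P]_w _ = P (X j @^-1` B)); last first.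
    exact: (int_indic (X j @^-1` B) (mXB _ _ mB)).
  by apply: (le_lt_trans (probability_le1 _ (mXB _ _ mB))); rewrite ltry.
- move=> j js; rewrite /g'; case: ifPn => ji; first by exists B.
  by apply: gB; rewrite in_cons negb_or ji.
Qed.

End independence.

(** * Exponential moments and tails *)

Section exponential_bounds.
Context (R : realType).
Implicit Types x y l T : R.

(** The bound [1 - x <= expR (- x)] gives [expR x - 1 <= x * expR x], hence
    [expR x - 1 - x <= x * (expR x - 1)]; the same argument bounds the right-hand side. *)
Lemma expR_le_quadratic x : expR x <= 1 + x + x ^+ 2 * expR `|x|.
Proof.
have e1 : 1 - x <= expR (- x) := expR_ge1Dx (- x).
have e2 : 1 + x <= expR x := expR_ge1Dx x.
have e0 := expR_gt0 x.
have e3 : expR x - 1 <= x * expR x.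
  have : expR x * (1 - x) <= expR x * expR (- x) by rewrite ler_pM2l.
  by rewrite -expRD subrr expR0; lra.
have [x0|x0] := leP 0 x; first by rewrite ger0_norm//; nra.
rewrite ltr0_norm//.
have e4 : 1 <= expR (- x) by rewrite -expR0 ler_expR; lra.
have e5 : expR x - 1 - x <= x * (expR x - 1) by lra.
have : x * (expR x - 1) <= x ^+ 2 by nra.
have : x ^+ 2 <= x ^+ 2 * expR (- x) by rewrite ler_peMr// sqr_ge0.
by lra.
Qed.

(** The quadratic remainder is absorbed into [expR (y / T ^+ 2)], whose mean is under control: one
    half of the exponent pays for [expR |l * y|], the other half for the square of [y / T ^+ 2]. *)
Lemma expR_scale_le_quadratic y l T : 0 <= y -> 0 < T ->
  `|l| <= (2 * T ^+ 2)^-1 ->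
  expR (l * y) <= 1 + l * y + 16 * l ^+ 2 * T ^+ 4 * expR (y / T ^+ 2).
Proof.
move=> y0 T0 lT; apply: le_trans (expR_le_quadratic _) _; rewrite lerD2l.
have T2 : 0 < T ^+ 2 by rewrite exprn_gt0.
have yE : y = T ^+ 2 * (y / T ^+ 2) by field; rewrite gt_eqF.
have a0 : 0 <= y / T ^+ 2 by rewrite divr_ge0// ltW.
move: (y / T ^+ 2) yE a0 => a yE a0.
have la : `|l * y| <= a / 2.
  rewrite normrM (ger0_norm y0) yE.
  rewrite (_ : a / 2 = (2 * T ^+ 2)^-1 * (T ^+ 2 * a)).
    by rewrite ler_wpM2r// mulr_ge0// ltW.
  by field; rewrite gt_eqF.
(* The square of [1 + a / 4 <= expR (a / 4)]; this is where 16 comes from. *)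
have ea : a ^+ 2 <= 16 * expR (a / 2).
  have -> : a / 2 = a / 4 + a / 4 by field.
  rewrite expRD; have := expR_ge1Dx (a / 4); have := expR_ge0 (a / 4).
  by nra.
have -> : 16 * l ^+ 2 * T ^+ 4 * expR a =
    (l ^+ 2 * T ^+ 4) * (16 * expR (a / 2) * expR (a / 2)).
  rewrite -[_ * expR (a / 2) * _]mulrA -expRD -splitr; ring.
have -> : (l * y) ^+ 2 * expR `|l * y| =
    (l ^+ 2 * T ^+ 4) * (a ^+ 2 * expR `|l * y|).
  by rewrite [in LHS]yE {1}yE; ring.
apply: ler_wpM2l; first by rewrite mulr_ge0 ?exprn_even_ge0.
by apply: ler_pM; rewrite ?sqr_ge0 ?expR_ge0 ?ler_expR.
Qed.

End exponential_bounds.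

Section tails.
Context (d : measure_display) (Omega : measurableType d) (R : realType).
Variable P : probability Omega R.

(** The mean of the pointwise quadratic bound: the linear term contributes [l], the remainder at
    most [2 * 16], and [1 + x <= expR x] restores an exponential. The factor [T ^+ 4] here becomes
    the [F ^+ 4] of the theorem. *)
Lemma exp_moment_le (Y : Omega -> R) (T l : R) :
  measurable_fun setT Y -> (forall w, 0 <= Y w) ->
  (\int[P]_w (Y w)%:E = 1)%E ->
  (\int[P]_w (expR (Y w / T ^+ 2))%:E <= 2%:E)%E ->
  0 < T -> `|l| <= (2 * T ^+ 2)^-1 ->
  (\int[P]_w (expR (l * Y w))%:E <= (expR (l + 32 * l ^+ 2 * T ^+ 4))%:E)%E.
Proof.
move=> mY Y0 EY EexpY T0 lT.
pose E w := expR (Y w / T ^+ 2); pose c := 16 * l ^+ 2 * T ^+ 4.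
have c0 : 0 <= c.
  by apply: mulr_ge0; [apply: mulr_ge0; rewrite ?sqr_ge0|exact: exprn_even_ge0].
have mE : measurable_fun setT E.
  by apply: measurableT_comp => //; exact: measurable_funM.
have iY : P.-integrable setT (EFin \o Y).
  apply/integrableP; split; first exact/measurable_EFinP.
  under eq_integral do rewrite /= ger0_norm//.
  by rewrite EY ltry.
have iE : P.-integrable setT (EFin \o E).
  apply/integrableP; split; first exact/measurable_EFinP.
  under eq_integral do rewrite /= ger0_norm ?expR_ge0//.
  by rewrite (le_lt_trans EexpY)// ltry.
have i1 : P.-integrable setT (EFin \o (fun=> 1 : R)).
  exact: finite_measure_integrable_cst.
have ilY : P.-integrable setT (EFin \o (fun w => l * Y w)).
  exact: (integrableZl _ l iY).
have icE : P.-integrable setT (EFin \o (fun w => c * E w)).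
  exact: (integrableZl _ c iE).
have i1lY : P.-integrable setT (EFin \o (fun w => 1 + l * Y w)).
  exact: (integrableD _ i1 ilY).
apply: (@le_trans _ _ (\int[P]_w (1 + l * Y w + c * E w)%:E)%E).
  apply: ge0_le_integral => //.
  - apply/measurable_EFinP; apply: measurableT_comp => //.
    exact: measurable_funM.
  - apply/measurable_EFinP; apply: measurable_funD; last exact: measurable_funM.
    by apply: measurable_funD => //; exact: measurable_funM.
  - by move=> w _; rewrite lee_fin; exact: expR_scale_le_quadratic.
rewrite (integralD_EFin measurableT i1lY icE)/=.
rewrite (integralD_EFin measurableT i1 ilY)/=.
under [X in (_ + X + _)%E]eq_integral do rewrite EFinM.
rewrite (integralZl measurableT iY) EY mule1.
under [X in (_ + X)%E]eq_integral do rewrite EFinM.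
rewrite (integralZl measurableT iE) integral_cst//= probability_setT mule1.
apply: (@le_trans _ _ (1 + l + c * 2)%:E).
  rewrite !EFinD; apply: leeD2l; rewrite [leRHS]EFinM; apply: lee_wpmul2l.
    by rewrite lee_fin.
  exact: EexpY.
apply: (le_trans _ (_ : (1 + (l + 32 * l ^+ 2 * T ^+ 4))%:E <= _)%E).
  by rewrite lee_fin /c; lra.
by rewrite lee_fin expR_ge1Dx.
Qed.

Lemma measurable_preimage_itv (S : Omega -> R) (i : interval R) :
  measurable_fun setT S -> measurable [set w | S w \in i].
Proof.
move=> mS; rewrite -[X in measurable X]setTI.
exact: (mS _ _ (measurable_itv i)).
Qed.

Lemma exp_markov (S : Omega -> R) (c : R) : measurable_fun setT S ->
  (P [set w | (c <= S w)%R] <= (expR (- c))%:E * \int[P]_w (expR (S w))%:E)%E.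
Proof.
move=> mS.
have mA : measurable [set w | c <= S w].
  have := measurable_preimage_itv `[c, +oo[ mS.
  by under eq_set do rewrite in_itv/= andbT.
have meS : measurable_fun setT (fun w => (expR (S w))%:E).
  by apply/measurable_EFinP; exact: measurableT_comp.
rewrite -ge0_integralZl_EFin ?expR_ge0//.
rewrite -[X in P X]setIT -integral_indic//.
apply: ge0_le_integral => //.
- by apply/measurable_EFinP; exact: measurable_indic.
- exact: emeasurable_funM.
- move=> w _; rewrite -EFinM -expRD lee_fin indicE.
  have [cS|cS] := leP c (S w); last first.
    by rewrite memNset ?expR_ge0//=; apply/negP; rewrite -ltNge.
  by rewrite mem_set//= -[leLHS]expR0 ler_expR; lra.
Qed.

Section sums.
Context (d' : measure_display) (T' : measurableType d') (m : nat).
Context (X : 'I_m -> Omega -> T') (g : T' -> R) (T : R).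
Hypotheses (mX : forall i, measurable_fun setT (X i))
  (indep : mutually_independent P X)
  (mg : measurable_fun setT g) (g0 : forall t, 0 <= g t)
  (EgX : forall i, (\int[P]_w (g (X i w))%:E = 1)%E)
  (EexpgX : forall i, (\int[P]_w (expR (g (X i w) / T ^+ 2))%:E <= 2%:E)%E)
  (T1 : 1 <= T).

Let mgX i : measurable_fun setT (fun w => g (X i w)).
Proof. exact: (measurableT_comp mg (mX i)). Qed.

Let T0 : 0 < T. Proof. exact: lt_le_trans T1. Qed.

(** Either sign of [l] is allowed, so one bound serves both tails. *)
Lemma independent_sum_chernoff (l c : R) : `|l| <= (2 * T ^+ 2)^-1 ->
  (P [set w | (c <= l * \sum_i g (X i w))%R] <=
   (expR (m%:R * (l + 32 * l ^+ 2 * T ^+ 4) - c))%:E)%E.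
Proof.
move=> lT.
apply: le_trans (exp_markov _ _) _.
  by apply: measurable_funM => //; exact: measurable_sum.
rewrite addrC expRD EFinM lee_wpmul2l ?lee_fin ?expR_ge0//.
have mexp : measurable_fun setT (fun t => expR (l * g t)).
  by apply: measurableT_comp => //; exact: measurable_funM.
have mom i := exp_moment_le (mgX i) (fun w => g0 (X i w)) (EgX i)
  (EexpgX i) T0 lT.
rewrite (_ : \int[P]_w _ =
    \int[P]_w (\prod_i expR (l * g (X i w)))%:E)%E; last first.
  by apply: eq_integral => w _; rewrite mulr_sumr expR_sum.
rewrite (@independent_integral_prod _ _ _ _ _ _ _ X (fun _ t => expR (l * g t)))//;
  last by move=> i; rewrite (le_lt_trans (mom i))// ltry.
rewrite expRM_natl -[m in leRHS]card_ord -prodr_const -prodEFin.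
(* Nonnegativity is carried along because products are monotone only between nonnegative factors. *)
suff /andP[] : (0 <= \prod_(i < m) \int[P]_w (expR (l * g (X i w)))%:E)%E &&
   (\prod_(i < m) \int[P]_w (expR (l * g (X i w)))%:E <=
    \prod_(i < m) (expR (l + 32 * l ^+ 2 * T ^+ 4))%:E)%E by [].
elim/big_ind2 : _ => [|x x' y y' /andP[x0 xx'] /andP[y0 yy']|i _].
- by rewrite lee_fin ler01 lexx.
- by rewrite mule_ge0// lee_pmul.
- by rewrite mom integral_ge0// => w _; rewrite lee_fin expR_ge0.
Qed.

Let mS : measurable_fun setT (fun w => \sum_i g (X i w)).
Proof. exact: measurable_sum. Qed.

Let mge (l c : R) : measurable [set w | c <= l * \sum_i g (X i w)].
Proof.
have := measurable_preimage_itv `[c, +oo[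
  (measurable_funM (measurable_cst l) mS).
by under eq_set do rewrite in_itv/= andbT.
Qed.

(** With a negative sign, this [l] minimises the lower tail exponent
    [m * (l / 2 + 32 * l ^+ 2 * T ^+ 4)]. It is admissible since [T ^+ 2 <= T ^+ 4]. *)
Let tail_exponent (l : R) : `|l| = (128 * T ^+ 4)^-1 ->
  `|l| <= (2 * T ^+ 2)^-1 /\
  m%:R * (32 * l ^+ 2 * T ^+ 4) = m%:R / (512 * T ^+ 4).
Proof.
move=> lE; split.
  rewrite lE lef_pV2 ?posrE ?mulr_gt0 ?exprn_gt0//.
  have : T ^+ 2 <= T ^+ 4 by rewrite ler_weXn2l.
  by have := exprn_gt0 2 T0; lra.
rewrite -(real_normK (num_real l)) lE; field.
by rewrite gt_eqF.
Qed.

Lemma sum_lower_tail :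
  (P [set w | (\sum_i g (X i w) < m%:R / 2)%R] <=
    (expR (- (m%:R / (512 * T ^+ 4))))%:E)%E.
Proof.
pose l := - (128 * T ^+ 4)^-1.
have T4 : 0 < T ^+ 4 by rewrite exprn_gt0.
have l0 : l < 0 by rewrite oppr_lt0 invr_gt0 mulr_gt0.
have lE : `|l| = (128 * T ^+ 4)^-1.
  by rewrite ltr0_norm// opprK.
have [lT lm] := tail_exponent lE.
apply: (@le_trans _ _ (P [set w | (l * (m%:R / 2) <= l * \sum_i g (X i w))%R])).
  apply: le_measure; rewrite ?inE.
  - have := measurable_preimage_itv `]-oo, m%:R / 2[ mS.
    by under eq_set do rewrite in_itv/=.
  - exact: mge.
  - by move=> w /= wm; rewrite ler_nM2l// ltW.
apply: le_trans (independent_sum_chernoff _ lT) _.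
rewrite lee_fin ler_expR mulrDr lm /l.
rewrite le_eqVlt; apply/orP; left; apply/eqP.
by field; rewrite gt_eqF.
Qed.

Lemma sum_upper_tail :
  (P [set w | (2 * m%:R < \sum_i g (X i w))%R] <=
    (expR (- (m%:R / (512 * T ^+ 4))))%:E)%E.
Proof.
pose l := (128 * T ^+ 4)^-1.
have T4 : 0 < T ^+ 4 by rewrite exprn_gt0.
have l0 : 0 < l by rewrite invr_gt0 mulr_gt0.
have lE : `|l| = (128 * T ^+ 4)^-1.
  by rewrite gtr0_norm.
have [lT lm] := tail_exponent lE.
apply: (@le_trans _ _ (P [set w | (l * (2 * m%:R) <= l * \sum_i g (X i w))%R])).
  apply: le_measure; rewrite ?inE.
  - have := measurable_preimage_itv `]2 * m%:R, +oo[ mS.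
    by under eq_set do rewrite in_itv/= andbT.
  - exact: mge.
  - by move=> w /= wm; rewrite ler_pM2l// ltW.
apply: le_trans (independent_sum_chernoff _ lT) _.
rewrite lee_fin ler_expR mulrDr lm /l.
(* The deviation from the mean is [m] instead of [m / 2], so the exponent is three times the
   required one. *)
rewrite [leLHS](_ : _ = - (3 * (m%:R / (512 * T ^+ 4)))); last first.
  by field; rewrite gt_eqF.
have : 0 <= m%:R / (512 * T ^+ 4).
  by apply: divr_ge0; [exact: ler0n|apply: mulr_ge0; [exact: ler0n|exact: ltW]].
by move: (m%:R / _) => q; lra.
Qed.

End sums.
End tails.

(** * Isotropic sub-gaussian vectors *)

Section isotropic_subgaussian.
Context (d : measure_display) (Omega : measurableType d) (R : realType).
Variable P : probability Omega R.

Lemma isotropic_sqr_vdot (n : nat) (X : Omega -> 'cV[R]_n) (a : 'cV[R]_n) :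
  (forall i, measurable_fun setT (fun w => X w i 0)) -> isotropic P X ->
  (\int[P]_w (vdot a (X w) ^+ 2)%:E = (sqnorm a)%:E)%E.
Proof.
move=> mX isoX.
have EXX i j : (\int[P]_w (X w i 0 * X w j 0)%:E = (i == j)%:R%:E)%E.
  have := isoX i j; rewrite unlock mxE => <-.
  by apply: eq_integral => w _; rewrite mxE big_ord1 mxE.
have mXX i j : measurable_fun setT (fun w => X w i 0 * X w j 0).
  exact: measurable_funM.
have iXii i : P.-integrable setT (EFin \o (fun w => X w i 0 * X w i 0)).
  apply/integrableP; split; first exact/measurable_EFinP.
  under eq_integral do rewrite /= ger0_norm -?expr2 ?sqr_ge0// expr2.
  by rewrite EXX ltry.
(* Mixed products are dominated by the sum of the two squares, whose integrals are finite; the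
   double sum can then be integrated term by term. *)
have iXX i j : P.-integrable setT (EFin \o (fun w => X w i 0 * X w j 0)).
  apply: (le_integrable measurableT _ _
    (integrableD measurableT (iXii i) (iXii j))).
    exact/measurable_EFinP.
  move=> w _; rewrite /= lee_fin [leRHS]ger0_norm; last first.
    by rewrite addr_ge0 // -expr2 sqr_ge0.
  by rewrite ler_norml; apply/andP; split; nra.
transitivity (\int[P]_w \sum_(k : 'I_n * 'I_n)
    ((a k.1 0 * a k.2 0)%:E * (X w k.1 0 * X w k.2 0)%:E))%E.
  apply: eq_integral => w _; rewrite -(pair_bigA _ (fun i j =>
    ((a i 0 * a j 0)%:E * (X w i 0 * X w j 0)%:E)%E))/=.
  under eq_bigr do rewrite sumEFin; rewrite sumEFin; congr (_%:E).
  rewrite /vdot mxE expr2 mulr_suml; apply: eq_bigr => i _.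
  by rewrite mulr_sumr; apply: eq_bigr => j _; rewrite !mxE; ring.
rewrite integral_sum//; last by move=> k; apply: integrableZl => //; exact: iXX.
under eq_bigr do rewrite (integralZl measurableT (iXX _ _)) EXX -EFinM.
rewrite sumEFin; congr (_%:E).
rewrite -(pair_bigA _ (fun i j => a i 0 * a j 0 * (i == j)%:R))/=.
apply: eq_bigr => i _; rewrite (bigD1 i)//= big1 ?addr0 ?eqxx ?mulr1 ?expr2//.
by move=> j /negbTE ji; rewrite eq_sym ji mulr0.
Qed.

(** A strict inequality provides an admissible [t] below [T], whether or not the infimum is
    attained, and the integrand decreases in the scale. *)
Lemma psi2_norm_lt (Y : Omega -> R) (T : R) : measurable_fun setT Y ->
  (psi2_norm P Y < T%:E)%E ->
  (\int[P]_w (expR (Y w ^+ 2 / T ^+ 2))%:E <= 2%:E)%E.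
Proof.
move=> mY /ereal_inf_lt[_ [t [t0 Et] <-]]; rewrite lte_fin => tT.
apply: le_trans Et; rewrite unlock.
have mexp r : measurable_fun setT (fun w => (expR (Y w ^+ 2 / r))%:E).
  apply/measurable_EFinP; apply: measurableT_comp => //.
  by apply: measurable_funM => //; exact: measurable_funX.
under [leRHS]eq_integral do rewrite real_normK ?num_real//.
apply: ge0_le_integral => //.
move=> w _; rewrite lee_fin ler_expR ler_wpM2l ?sqr_ge0//.
have T0 : 0 < T := lt_trans t0 tT.
by rewrite lef_pV2 ?posrE ?exprn_gt0// lerXn2r ?nnegrE
  ?(ltW T0) ?(ltW t0) ?(ltW tT).
Qed.

(** By [1 + x <= expR x] the exponential moment at scale [t] is at least [1 + 1 / t ^+ 2], which
    exceeds 2 when [t < 1]. This yields [1 <= F]. *)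
Lemma psi2_norm_ge1 (Y : Omega -> R) : measurable_fun setT Y ->
  (\int[P]_w (Y w ^+ 2)%:E = 1)%E -> (1 <= psi2_norm P Y)%E.
Proof.
move=> mY EY; apply: le_ereal_inf_tmp => _ [t [t0 Et] <-].
rewrite lee_fin leNgt; apply/negP => t1.
have t2 : 0 < t ^+ 2 by rewrite exprn_gt0.
have mY2 : measurable_fun setT (fun w => (Y w ^+ 2)%:E).
  by apply/measurable_EFinP; exact: measurable_funX.
have : (\int[P]_w (1 + (t ^+ 2)^-1%:E * (Y w ^+ 2)%:E) <= 2%:E)%E.
  apply: le_trans Et; rewrite unlock; apply: ge0_le_integral => //.
  - move=> w _; rewrite adde_ge0// mule_ge0// lee_fin ?sqr_ge0// invr_ge0 ltW//.
  - by apply: emeasurable_funD => //; exact: emeasurable_funM.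
  - apply/measurable_EFinP; apply: measurableT_comp => //.
    apply: measurable_funM => //; apply: measurable_funX.
    exact: measurableT_comp.
  - move=> w _; rewrite -EFinM -EFinD lee_fin real_normK ?num_real//.
    by rewrite mulrC expR_ge1Dx.
rewrite ge0_integralD//; last 2 first.
- by move=> w _; rewrite mule_ge0// lee_fin ?sqr_ge0// invr_ge0 ltW.
- exact: emeasurable_funM.
rewrite ge0_integralZl_EFin//; last 2 first.
- by move=> w _; rewrite lee_fin sqr_ge0.
- by rewrite invr_ge0 ltW.
rewrite EY mule1 integral_cst//= probability_setT mule1 -EFinD lee_fin.
have : 1 < (t ^+ 2)^-1 by rewrite invf_gt1// expr_lt1// ltW.
by lra.
Qed.

End isotropic_subgaussian.

(** * The random matrix *)

Lemma sqr_l2norm (R : realType) (n : nat) (z : 'cV[R]_n) :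
  l2norm z ^+ 2 = sqnorm z.
Proof. by rewrite sqr_sqrtr//; apply: sumr_ge0 => i _; exact: sqr_ge0. Qed.

Lemma l2norm_delta (R : realType) (n : nat) (j : 'I_n) :
  l2norm (delta_mx j 0 : 'cV[R]_n) = 1.
Proof.
rewrite /l2norm (bigD1 j)//= big1 ?addr0; last first.
  by move=> i ij; rewrite mxE (negbTE ij) expr0n.
by rewrite mxE !eqxx expr1n sqrtr1.
Qed.

Lemma bigsetU_prob_le (d : measure_display) (Omega : measurableType d)
    (R : realType) (P : probability Omega R) (I : finType) (B : I -> set Omega)
    (b : R) :
  (forall i, measurable (B i)) -> (forall i, (P (B i) <= b%:E)%E) ->
  (P (\big[setU/set0]_i B i) <= (#|I|%:R * b)%:E)%E.
Proof.
move=> mB PB; have -> : #|I| = size (index_enum I).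
  by rewrite cardT enumT [index_enum _]unlock.
elim: (index_enum I) => [|i s IHs]; first by rewrite big_nil measure0 mul0r.
rewrite big_cons [size _]/= [_ * b](_ : _ = b + (size s)%:R * b); last first.
  by rewrite -natr1; ring.
rewrite EFinD.
apply: le_trans (measureU2 _ _ _) _ => //; first exact: bigsetU_measurable.
by apply: leeD; [exact: PB|exact: IHs].
Qed.

Section random_matrix.
Context (d : measure_display) (Omega : measurableType d) (R : realType).
Context (P : probability Omega R) (m n : nat)
  (A : Omega -> 'M[R]_(m, n)) (T : R).
Hypotheses (mA : measurable_fun setT (A : Omega -> borel_mx R m n))
  (indepA : mutually_independent P (mx_row A : 'I_m -> Omega -> borel_mx R n 1))
  (isoA : forall i, isotropic P (mx_row A i))
  (T1 : 1 <= T)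
  (expA : forall i a, l2norm a = 1 ->
    (\int[P]_w (expR (vdot a (mx_row A i w) ^+ 2 / T ^+ 2))%:E <= 2%:E)%E).

Lemma measurable_mx_row i :
  measurable_fun setT (mx_row A i : Omega -> borel_mx R n 1).
Proof.
have cr : continuous (fun B : 'M[R]_(m, n) => (row i B)^T).
  apply: continuous_to_mx => j k B.
  rewrite (_ : (fun _ => _) = fun B : 'M[R]_(m, n) => B i j); last first.
    by apply/funext => C; rewrite !mxE.
  exact: coord_continuous.
exact: (measurableT_comp (continuous_borel_mx_map cr) mA).
Qed.

Lemma measurable_mx_entry i j : measurable_fun setT (fun w => A w i j).
Proof.
exact: (measurableT_comp (continuous_borel_mx_fun
  (@coord_continuous _ _ _ i j)) mA).
Qed.

Lemma measurable_vdot (a : 'cV[R]_n) :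
  measurable_fun setT (vdot a : borel_mx R n 1 -> R).
Proof.
apply: continuous_borel_mx_fun.
rewrite (_ : vdot a = fun x => \sum_j a j 0 * x j 0); last first.
  apply/funext => x; rewrite /vdot mxE.
  by apply: eq_bigr => j _; rewrite mxE.
apply: sum_continuous => j x; apply: continuousM; first exact: cst_continuous.
exact: coord_continuous.
Qed.

Lemma measurable_vdot_row (a : 'cV[R]_n) i :
  measurable_fun setT (fun w => vdot a (mx_row A i w)).
Proof. exact: (measurableT_comp (measurable_vdot a) (measurable_mx_row i)). Qed.

Lemma measurable_sqr_vdot (a : 'cV[R]_n) :
  measurable_fun setT
    ((fun x : 'cV[R]_n => vdot a x ^+ 2) : borel_mx R n 1 -> R).
Proof. exact: (measurable_funX 2 (measurable_vdot a)). Qed.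

Lemma sqnorm_mulmx (B : 'M[R]_(m, n)) (z : 'cV[R]_n) :
  sqnorm (B *m z) = \sum_i vdot z (row i B)^T ^+ 2.
Proof.
apply: eq_bigr => i _; congr (_ ^+ 2).
by rewrite /vdot !mxE; apply: eq_bigr => j _; rewrite !mxE mulrC.
Qed.

(** The bound on the failure probability of a single atom or column. *)
Let p : R := expR (- (m%:R / (512 * T ^+ 4))).

Lemma unit_moment i (a : 'cV[R]_n) : l2norm a = 1 ->
  (\int[P]_w (vdot a (mx_row A i w) ^+ 2)%:E = 1)%E.
Proof.
move=> a1; rewrite isotropic_sqr_vdot//.
  by rewrite -sqr_l2norm a1 expr1n.
move=> j; rewrite (_ : (fun _ => _) = fun w => A w i j); last first.
  by apply/funext => w; rewrite !mxE.
exact: measurable_mx_entry.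
Qed.

Lemma sqnorm_lower_tail (z : 'cV[R]_n) :
  (P [set w | (sqnorm (A w *m z) < m%:R / 2 * sqnorm z)%R] <= p%:E)%E.
Proof.
(* A vanishing atom cannot be normalised, but the strict inequality never holds for it. *)
have [->|z0] := eqVneq z 0.
  rewrite [X in P X](_ : _ = set0) ?measure0 ?lee_fin ?expR_ge0//.
  apply/seteqP; split => // w /=; rewrite mulmx0 /sqnorm !big1 ?mulr0 ?ltxx//;
    by move=> i _; rewrite mxE expr0n.
pose a := (l2norm z)^-1 *: z.
have lz := l2norm_gt0 z0.
have a1 : l2norm a = 1.
  by rewrite l2normZ gtr0_norm ?invr_gt0// mulVf// gt_eqF.
have := sum_lower_tail measurable_mx_row indepA (measurable_sqr_vdot a)
  (fun x => sqr_ge0 _) (fun i => unit_moment i a1) (fun i => expA i a1) T1.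
apply: le_trans; rewrite le_eqVlt; apply/orP; left; apply/eqP; congr (P _).
apply/seteqP.
have E w : (sqnorm (A w *m z) < m%:R / 2 * sqnorm z) =
    (\sum_i vdot a (mx_row A i w) ^+ 2 < m%:R / 2).
  rewrite -(sqr_l2norm z) -ltr_pdivrMr ?exprn_gt0//.
  suff -> : sqnorm (A w *m z) / l2norm z ^+ 2 =
    \sum_i vdot a (mx_row A i w) ^+ 2 by [].
  rewrite sqnorm_mulmx mulr_suml; apply: eq_bigr => i _.
  rewrite -exprVn -exprMn; congr (_ ^+ 2).
  by rewrite /a /vdot linearZ/= -scalemxAl [in RHS]mxE mulrC.
by split => w /=; rewrite E.
Qed.

Lemma col_upper_tail (j : 'I_n) :
  (P [set w | (2 * m%:R < \sum_i A w i j ^+ 2)%R] <= p%:E)%E.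
Proof.
pose a : 'cV[R]_n := delta_mx j 0.
have a1 : l2norm a = 1 := l2norm_delta R j.
have := sum_upper_tail measurable_mx_row indepA (measurable_sqr_vdot a)
  (fun x => sqr_ge0 _) (fun i => unit_moment i a1) (fun i => expA i a1) T1.
apply: le_trans; rewrite le_eqVlt; apply/orP; left; apply/eqP; congr (P _).
apply/seteqP.
have E w : \sum_i A w i j ^+ 2 = \sum_i vdot a (mx_row A i w) ^+ 2.
  apply: eq_bigr => i _; congr (_ ^+ 2).
  by rewrite /vdot /a trmx_delta -rowE !mxE.
by split => w /=; rewrite E.
Qed.

(** Union bound over the [(2 * n) ^ k] atoms and the [n] columns. With [k - 1 = 28 * s], the
    comparison on the kernel rules out a ratio of [3 * Num.sqrt s], which would need
    [28 * s <= 27 * s]; the slack leaves room for a strict bound on the infimum. *)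
Lemma ker_ratio_gt_prob (s : nat) : (0 < m)%N -> (0 < s)%N ->
  ((1 - ((2 * n)%N%:R ^+ (28 * s).+1 + n%:R) * p)%:E <=
    P [set w | ((3 * Num.sqrt s%:R)%:E < ker_ratio (A w))%E])%E.
Proof.
move=> m0 s0; set k := (28 * s).+1.
set E := [set w | _].
have c0 : 0 <= 3 * Num.sqrt s%:R :> R by rewrite mulr_ge0// sqrtr_ge0.
have mE : measurable E.
  have oU := @open_ker_ratio_gt R m n _ c0.
  by have := mA measurableT (open_measurable_borel_mx oU); rewrite setTI.
pose B (f : k.-tuple ('I_n * bool)) :=
  [set w | sqnorm (A w *m atom R f) < m%:R / 2 * sqnorm (atom R f)].
pose C (j : 'I_n) := [set w | 2 * m%:R < \sum_i A w i j ^+ 2].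
have mB f : measurable (B f).
  have mS : measurable_fun setT (fun w => sqnorm (A w *m atom R f)).
    under eq_fun do rewrite sqnorm_mulmx.
    apply: measurable_sum => i.
    exact: (measurableT_comp (measurable_sqr_vdot (atom R f))
      (measurable_mx_row i)).
  have := measurable_preimage_itv `]-oo, m%:R / 2 * sqnorm (atom R f)[ mS.
  by under eq_set do rewrite in_itv/=.
have mC j : measurable (C j).
  have mS : measurable_fun setT (fun w => \sum_i A w i j ^+ 2).
    apply: measurable_sum => i; apply: measurable_funX.
    exact: measurable_mx_entry.
  have := measurable_preimage_itv `]2 * m%:R, +oo[ mS.
  by under eq_set do rewrite in_itv/= andbT.
pose UB := \big[setU/set0]_f B f; pose UC := \big[setU/set0]_j C j.
have mUB : measurable UB by exact: bigsetU_measurable.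
have mUC : measurable UC by exact: bigsetU_measurable.
have sub : ~` E `<=` UB `|` UC.
  move=> w; apply: contra_notP => /not_orP[wB wC].
  (* any [c] with [3 < c] and [3 * c ^+ 2 < 28] would do for [61 / 20] *)
  apply/(ker_ratio_gtP _ c0); exists (61 / 20 * Num.sqrt s%:R).
    by rewrite ltr_pM2r ?sqrtr_gt0 ?ltr0n//; lra.
  move=> v [v1 vq]; rewrite /=; apply/eqP => Av.
  have v0 : v^T != 0.
    apply/eqP => v0; move: v1; rewrite -[v]trmxK v0 big1.
      by move/esym/eqP; rewrite oner_eq0.
    by move=> i _; rewrite !mxE expr0n.
  have atoms (f : k.-tuple ('I_n * bool)) :
      m%:R / 2 * sqnorm (atom R f) <= sqnorm (A w *m atom R f).
    rewrite leNgt; apply/negP => wf; apply: wB.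
    by rewrite /UB -bigcup_seq; exists f; rewrite //= mem_index_enum.
  have cols j : \sum_i A w i j ^+ 2 <= 2 * m%:R.
    rewrite leNgt; apply/negP => wj; apply: wC.
    by rewrite /UC -bigcup_seq; exists j; rewrite //= mem_index_enum.
  have := ker_l1_l2 (ltn0Sn _) m0 atoms cols v0 Av.
  have -> : sqnorm v^T = 1 by rewrite -v1; apply: eq_bigr => i _; rewrite mxE.
  have -> : l1norm v^T = \sum_i `|v 0 i| by apply: eq_bigr => i _; rewrite mxE.
  apply/negP; rewrite -ltNge mulr1 /k -[X in X - 1]natr1 addrK natrM.
  have s0' : 0 < s%:R :> R by rewrite ltr0n.
  have : (\sum_i `|v 0 i|) ^+ 2 <= (61 / 20 * Num.sqrt s%:R) ^+ 2.
    rewrite lerXn2r// nnegrE; first by apply: sumr_ge0 => i _.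
    by rewrite mulr_ge0// sqrtr_ge0.
  by rewrite exprMn sqr_sqrtr ?ler0n//; lra.
have PnE : (P (~` E) <= (((2 * n)%N%:R ^+ k + n%:R) * p)%:E)%E.
  apply: le_trans (le_measure _ _ _ sub) _; rewrite ?inE.
  - exact: measurableC.
  - exact: measurableU.
  apply: le_trans (measureU2 _ _ _) _ => //.
  rewrite mulrDl EFinD; apply: leeD.
    have := bigsetU_prob_le mB (fun f => sqnorm_lower_tail (atom R f)).
    by rewrite card_tuple card_prod card_ord card_bool natrX mulnC.
  have := bigsetU_prob_le mC col_upper_tail.
  by rewrite card_ord.
rewrite -[E]setCK probability_setC; last exact: measurableC.
rewrite EFinB leeB//.
Qed.

End random_matrix.

(** * Numerical constants and the theorem *)

(** Since [2 * n <= n ^ 2] and [1 <= s], the atoms number at most [n ^ (58 * s)], and so do the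
    columns; each kind uses one of the two [expR (- u)]. Of the constant 60, 58 pays for this count
    and 2 for [u], as [ln n * s] is at least one half. *)
Lemma union_bound_numerics (R : realType) (n s : nat) (u q : R) :
  (2 <= n)%N -> (1 <= s)%N -> 1 <= u -> 60 * (u * ln n%:R * s%:R) <= q ->
  ((2 * n)%N%:R ^+ (28 * s).+1 + n%:R) * expR (- q) <= 2 * expR (- u).
Proof.
move=> n2 s1 u1 hq.
have n0 : 0 < n%:R :> R by rewrite ltr0n (leq_trans _ n2).
(* The bound [1 + x <= expR x] at [- 2^-1] gives [expR 2^-1 <= 2]. *)
have lnn : 2^-1 <= ln n%:R :> R.
  rewrite -[leLHS]expRK ler_ln ?posrE ?expR_gt0//.
  apply: (@le_trans _ _ 2); last by rewrite ler_nat.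
  have := expR_ge1Dx (- 2^-1 : R).
  have : expR (- 2^-1) * expR 2^-1 = 1 :> R by rewrite -expRD addNr expR0.
  by have := expR_gt0 (2^-1 : R); nra.
have s1' : 1 <= s%:R :> R by rewrite ler1n.
pose L := ln n%:R * s%:R : R.
have L2 : 2^-1 <= L by rewrite /L; nra.
have uL : 58 * L + u <= q.
  by apply: le_trans hq; rewrite -mulrA -/L; nra.
have pown : expR (58 * L) = n%:R ^+ (58 * s).
  rewrite (_ : 58 * L = (58 * s)%N%:R * ln n%:R); last first.
    by rewrite /L natrM; ring.
  by rewrite expRM_natl lnK.
have big : (2 * n)%N%:R ^+ (28 * s).+1 <= expR (58 * L).
  rewrite pown -!natrX ler_nat.
  apply: (@leq_trans ((n ^ 2) ^ (28 * s).+1)).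
    by rewrite leq_exp2r// leq_pmul2r ?(leq_trans _ n2).
  by rewrite -expnM leq_exp2l//; lia.
have small : n%:R <= expR (58 * L).
  rewrite pown -natrX ler_nat -[leqLHS]expn1 leq_exp2l//; lia.
have eq : expR (58 * L) * expR (- q) <= expR (- u).
  by rewrite -expRD ler_expR; lra.
by have := expR_ge0 (- q); nra.
Qed.

Lemma max_row_norm_ge (d : measure_display) (Omega : measurableType d)
    (R : realType) (P : probability Omega R) (m n : nat)
    (A : Omega -> 'M[R]_(m, n)) (i : 'I_m) (a : 'cV[R]_n) :
  l2norm a = 1 ->
  (psi2_norm P (fun w => vdot a (mx_row A i w)) <= max_row_norm P A)%E.
Proof.
move=> a1; apply: (@le_trans _ _ (subgaussian_norm P (mx_row A i))).
  by apply: ereal_sup_ubound; exists a.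
exact: (@le_bigmax _ _ _ _ (fun i => subgaussian_norm P (mx_row A i))).
Qed.

Theorem theorem4p4 (R : realType) :
  exists D : R, 0 < D /\
  forall (d : measure_display) (Omega : measurableType d)
    (P : probability Omega R) (m n : nat)
    (A : Omega -> 'M[R]_(m, n)) (u : R) (s : nat),
  (2 <= n)%N ->
  measurable_fun [set: Omega] (A : Omega -> borel_mx R m n) ->
  mutually_independent P (mx_row A : 'I_m -> Omega -> borel_mx R n 1) ->
  (forall i : 'I_m, isotropic P (mx_row A i)) ->
  (forall i : 'I_m, subgaussian P (mx_row A i)) ->
  1 <= u ->
  (1 <= s)%N ->
  (D%:E * max_row_norm P A ^+ 4 * (u * ln n%:R)%:E < (m%:R / s%:R)%:E)%E ->
  ((1 - 2 * expR (- u))%:E <=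
    P [set w | (3 * Num.sqrt s%:R)%:E < ker_ratio (A w)])%E.
Proof.
(* [2 ^+ 13 = 512 * 2 ^+ 4]: the tail bounds are used with [T = 2 F] *)
exists (60 * 2 ^+ 13); split; first by rewrite mulr_gt0// exprn_gt0.
move=> d Omega P m n A u s n2 mA indepA isoA _ u1 s1.
have s0 : 0 < s%:R :> R by rewrite ltr0n.
have uln0 : 0 < u * ln n%:R :> R.
  by rewrite mulr_gt0 ?(lt_le_trans _ u1)// ln_gt0// ltr1n.
have F0 : (0 <= max_row_norm P A)%E by exact: bigmax_ge_id.
have mvdot i a := measurable_vdot_row mA a i.
(* Without rows the assumption reads as a nonnegative number below 0. *)
case: (posnP m) => [m0|m0].
  have -> : m%:R / s%:R = 0 :> R by rewrite m0 mul0r.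
  move=> h; exfalso; move: h; apply/negP; rewrite -leNgt.
  by rewrite !mule_ge0 ?expe_ge0// lee_fin ?ltW.
(* One row tested against one basis vector is enough. *)
have F1 : (1 <= max_row_norm P A)%E.
  have i : 'I_m := Ordinal m0.
  have j : 'I_n := Ordinal (leq_trans (ltn0Sn 1) n2).
  have a1 : l2norm (delta_mx j 0 : 'cV[R]_n) = 1 by exact: l2norm_delta.
  apply: le_trans (max_row_norm_ge P A i a1); apply: psi2_norm_ge1 => //.
  exact: (unit_moment mA isoA).
have psi2_le i a := @max_row_norm_ge _ _ _ P _ _ A i a.
move: F0 F1 psi2_le; case: (max_row_norm P A) => [r| |]// _ F1 psi2_le.
  rewrite -EFin_expe -!EFinM lte_fin => hm.
  rewrite lee_fin in F1.
  have r0 : 0 < r by lra.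
  have T1 : 1 <= 2 * r by lra.
  have expA i (a : 'cV[R]_n) : l2norm a = 1 ->
    (\int[P]_w (expR (vdot a (mx_row A i w) ^+ 2 / (2 * r) ^+ 2))%:E <= 2%:E)%E.
    move=> a1; apply: psi2_norm_lt => //; apply: le_lt_trans (psi2_le i a a1) _.
    by rewrite lte_fin; lra.
  have := ker_ratio_gt_prob mA indepA isoA T1 expA m0 s1.
  apply: le_trans; rewrite lee_fin lerD2l lerN2.
  apply: union_bound_numerics => //.
  move: hm; rewrite ltr_pdivlMr// => hm.
  have r2 : 0 < 2 * r by exact: lt_le_trans T1.
  rewrite ler_pdivlMr; last first.
    by apply: mulr_gt0; [rewrite ltr0n|exact: exprn_gt0].
  apply: le_trans (ltW hm); rewrite le_eqVlt; apply/orP; left; apply/eqP; ring.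
(* If [F] is infinite, so is the left-hand side of the assumption, which is then false. *)
have -> : (+oo ^+ 4 = +oo :> \bar R)%E by rewrite !expeS expe0 mule1 !mulyy.
by rewrite gt0_muley ?lte_fin ?mulr_gt0 ?exprn_gt0// gt0_mulye ?lte_fin.
Qed.
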